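(* Let $\mathbf{x}_1,\dots,\mathbf{x}_N\in\mathbb{R}^K$, let $\mathbf{T}$ be a real symmetric positive definite $K\times K$ matrix, and let $\alpha_0>0$. Suppose that (i) $\mathbf{x}_i\neq\mathbf{0}$ for every $i$; (ii) for every proper subspace $S\subseteq\mathbb{R}^K$, $P_N(S)<\frac{(1+\alpha_0)\dim(S)}{K}$. Then the equation $$\boldsymbol{\Sigma}=\frac{1}{1+\alpha_0}\frac KN\sum_{i=1}^N\frac{\mathbf{x}_i\mathbf{x}_i^T}{\mathbf{x}_i^T\boldsymbol{\Sigma}^{-1}\mathbf{x}_i}+\frac{\alpha_0}{1+\alpha_0}\mathbf{T}$$ has a unique solution $\boldsymbol{\Sigma}\in\mathbb{S}_{++}^K$, and this solution is the global minimum over $\mathbb{S}_{++}^K$ of the loss function $$L^{\mathrm{KL}}(\boldsymbol{\Sigma})=\log\det(\boldsymbol{\Sigma})+\frac KN\sum_{i=1}^N\log\left(\mathbf{x}_i^T\boldsymbol{\Sigma}^{-1}\mathbf{x}_i\right)+\alpha_0\left(\mathrm{Tr}(\boldsymbol{\Sigma}^{-1}\mathbf{T})+\log\det(\boldsymbol{\Sigma})\right).$$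
   Context: $\mathbb{S}_{++}^K$ is the set of real symmetric positive definite $K\times K$ matrices. $P_N(S)=\frac1N\sum_{i=1}^N 1_{\{\mathbf{x}_i\in S\}}$ is the proportion of samples lying in $S$. ''Proper subspace'' means a linear subspace $S$ with $1\le\dim S\le K-1$. *)

(* Defs.v *)
From mathcomp Require Import all_boot all_order all_algebra.
From mathcomp Require Import all_classical all_reals all_analysis.

Set Implicit Arguments.
Unset Strict Implicit.
Unset Printing Implicit Defensive.

Import Order.TTheory GRing.Theory Num.Theory.

Local Open Scope ring_scope.

Definition qform (R : pzRingType) (K : nat) (A : 'M[R]_K) (v : 'cV[R]_K) : R :=
  (v^T *m A *m v) 0 0.

Definition posdefmx (R : numDomainType) (K : nat) (A : 'M[R]_K) : Prop :=
  A^T = A /\ forall v : 'cV[R]_K, v != 0 -> 0 < qform A v.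

Definition sample_prop (R : fieldType) (K N : nat) (x : 'I_N -> 'cV[R]_K)
    (S : {vspace 'cV[R]_K}) : R :=
  N%:R^-1 * \sum_(i < N) (x i \in S)%:R.

(* Invertibility of Sigma and positivity of the quadratic forms are not
   required here; [invmx], [_^-1] and [ln] have their usual meaning as soon as
   [posdefmx Sigma] holds and every [x i] is nonzero. *)
Definition kl_rhs (R : fieldType) (K N : nat) (x : 'I_N -> 'cV[R]_K)
    (T : 'M[R]_K) (alpha0 : R) (Sigma : 'M[R]_K) : 'M[R]_K :=
  (1 / (1 + alpha0) * (K%:R / N%:R)) *:
    (\sum_(i < N) (qform (invmx Sigma) (x i))^-1 *: (x i *m (x i)^T))
  + (alpha0 / (1 + alpha0)) *: T.

Definition kl_loss (R : realType) (K N : nat) (x : 'I_N -> 'cV[R]_K)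
    (T : 'M[R]_K) (alpha0 : R) (Sigma : 'M[R]_K) : R :=
  ln (\det Sigma)
  + K%:R / N%:R * \sum_(i < N) ln (qform (invmx Sigma) (x i))
  + alpha0 * (\tr (invmx Sigma *m T) + ln (\det Sigma)).

(* Main.v *)
From HB Require Import structures.
Require Import Defs.
From mathcomp Require Import all_boot all_order all_algebra.
From mathcomp Require Import all_classical all_reals all_analysis.
From mathcomp Require Import complex ring lra.

Set Implicit Arguments.
Unset Strict Implicit.
Unset Printing Implicit Defensive.

Import Order.TTheory GRing.Theory Num.Theory.
Import numFieldNormedType.Exports.

Local Open Scope ring_scope.

(** Uniqueness and minimality.  Diagonalise a solution [A] and any positive
    definite [B] simultaneously, [Q^T A Q = 1] and [Q^T B Q = diag d].  Jensen's
    inequality for [ln], with the weights [(Q^T x_i)_j^2 / |Q^T x_i|^2], and the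
    diagonal entries of the fixed-point equation give
    [L B - L A >= alpha0 * sum_j (Q^T T Q)_jj * (1 / d_j - 1 + ln d_j)], which is
    positive unless [B = A].  No convexity or differentiability is needed.

    Existence.  Since [1 / (x^T S^-1 x)] is the minimum of [y^T S y] over
    [y^T x = 1], the inequality [S <= f S], where [f] is the right-hand side of
    the equation, is a family of linear inequalities in [S].  Homogenised by a
    factor [s] in front of the prior term [b T], and normalised by [tr S = 1],
    the conditions [s b T <= S <= f S] cut out a compact set of pairs [(s, S)].
    The spread condition excludes [s = 0], so at the minimal [s] the matrix
    [A = S / s] has maximal trace among the solutions of [b T <= A <= f A].  As
    [f] is monotone, [f A] is again such a solution and [f A >= A], hence
    [f A = A]. *)

(** * Quadratic forms and definite matrices *)

Definition possemidefmx (R : numDomainType) (K : nat) (A : 'M[R]_K) : Prop :=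
  A^T = A /\ forall v : 'cV[R]_K, 0 <= qform A v.

Lemma qformD (R : pzRingType) K (A B : 'M[R]_K) v :
  qform (A + B) v = qform A v + qform B v.
Proof. by rewrite /qform mulmxDr mulmxDl mxE. Qed.

Lemma qformN (R : pzRingType) K (A : 'M[R]_K) v : qform (- A) v = - qform A v.
Proof. by rewrite /qform mulmxN mulNmx mxE. Qed.

Lemma qformB (R : pzRingType) K (A B : 'M[R]_K) v :
  qform (A - B) v = qform A v - qform B v.
Proof. by rewrite qformD qformN. Qed.

Lemma qformZ (R : comPzRingType) K a (A : 'M[R]_K) v :
  qform (a *: A) v = a * qform A v.
Proof. by rewrite /qform -scalemxAr -scalemxAl mxE. Qed.

Lemma qform0v (R : pzRingType) K (A : 'M[R]_K) : qform A 0 = 0.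
Proof. by rewrite /qform mulmx0 mxE. Qed.

Lemma qformM (R : comPzRingType) K L (A : 'M[R]_K) (P : 'M[R]_(K, L)) v :
  qform A (P *m v) = qform (P^T *m A *m P) v.
Proof. by rewrite /qform trmx_mul !mulmxA. Qed.

Lemma mx11_tr (R : pzRingType) (M : 'M[R]_1) : M^T = M.
Proof. by apply/matrixP=> i j; rewrite mxE !ord1. Qed.

Lemma posdefmx_semi (R : numDomainType) K (A : 'M[R]_K) :
  posdefmx A -> possemidefmx A.
Proof.
move=> [sA pA]; split=> // v; have [->|v0] := eqVneq v 0; first by rewrite qform0v.
exact/ltW/pA.
Qed.

Lemma posdefmx_unit (R : numFieldType) K (A : 'M[R]_K) :
  posdefmx A -> A \in unitmx.
Proof.
move=> [sA pA]; rewrite unitmxE unitfE; apply/det0P => -[v v0 vA].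
have vT0 : v^T != 0 by rewrite trmx_eq0.
by have := pA _ vT0; rewrite /qform trmxK vA mul0mx mxE ltxx.
Qed.

Lemma posdefmx_inv (R : numFieldType) K (A : 'M[R]_K) :
  posdefmx A -> posdefmx (invmx A).
Proof.
move=> pdA; have uA := posdefmx_unit pdA; case: (pdA) => sA pA.
split; first by rewrite trmx_inv sA.
move=> v v0; have -> : v = A *m (invmx A *m v) by rewrite mulKVmx.
rewrite qformM sA mulmxV // mul1mx; apply: pA.
by apply: contra v0 => /eqP e; rewrite -(mulKVmx uA v) e mulmx0.
Qed.

(** * Simultaneous diagonalisation of two symmetric matrices *)

Lemma map_Re_mulmx (R : rcfType) m n p (v : 'M[R[i]]_(m, n)) (B : 'M[R]_(n, p)) :
  map_mx (@complex.Re R) (v *m map_mx (real_complex R) B)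
  = map_mx (@complex.Re R) v *m B.
Proof.
apply/matrixP => i j; rewrite !mxE.
rewrite (big_morph (@complex.Re R) (id1 := 0) (op1 := +%R)) //; last by case=> ? ? [].
by apply: eq_bigr => k _; rewrite !mxE; case: (v i k) => a b /=; ring.
Qed.

Lemma map_Im_mulmx (R : rcfType) m n p (v : 'M[R[i]]_(m, n)) (B : 'M[R]_(n, p)) :
  map_mx (@complex.Im R) (v *m map_mx (real_complex R) B)
  = map_mx (@complex.Im R) v *m B.
Proof.
apply/matrixP => i j; rewrite !mxE.
rewrite (big_morph (@complex.Im R) (id1 := 0) (op1 := +%R)) //; last by case=> ? ? [].
by apply: eq_bigr => k _; rewrite !mxE; case: (v i k) => a b /=; ring.
Qed.

(* A complex eigenvalue [al + i be] of [B A^-1] with eigenvector [p + i q] is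
   real: symmetry of [A] and [B] gives
   [be * (qform A p^T + qform A q^T) = 0]. *)
Lemma pencil_eigenvector (R : rcfType) n (A B : 'M[R]_n.+1) :
  posdefmx A -> B^T = B ->
  exists (l : R) (u : 'cV[R]_n.+1), u != 0 /\ B *m u = l *: (A *m u).
Proof.
move=> pdA sB; have uA := posdefmx_unit pdA; case: (pdA) => sA pA.
have [a] : exists a, root (char_poly (map_mx (real_complex R) (B *m invmx A))) a.
  by apply/closed_rootP; rewrite size_char_poly.
rewrite -eigenvalue_root_char => /eigenvalueP [v vE v0].
have {}vE : v *m map_mx (real_complex R) B = a *: (v *m map_mx (real_complex R) A).
  by rewrite scalemxAl -vE -mulmxA -map_mxM mulmxKV.
pose p := map_mx (@complex.Re R) v; pose q := map_mx (@complex.Im R) v.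
case: a vE => al be vE.
have pE : p *m B = al *: (p *m A) - be *: (q *m A).
  rewrite -!map_Re_mulmx -!map_Im_mulmx vE; apply/matrixP => i j.
  by rewrite !mxE; case: (\sum_j0 _) => c d.
have qE : q *m B = be *: (p *m A) + al *: (q *m A).
  rewrite -!map_Re_mulmx -!map_Im_mulmx vE; apply/matrixP => i j.
  by rewrite !mxE; case: (\sum_j0 _) => c d /=; ring.
have symAB (M : 'M[R]_n.+1) : M^T = M -> p *m M *m q^T = q *m M *m p^T.
  by move=> sM; rewrite -[LHS]mx11_tr !trmx_mul trmxK sM mulmxA.
have qfE w : (w *m A *m w^T) 0 0 = qform A w^T by rewrite /qform trmxK.
have nz : (p != 0) || (q != 0).
  rewrite -negb_and; apply: contra v0 => /andP [/eqP p0 /eqP q0].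
  apply/eqP/matrixP => i j; have := congr1 (fun M : 'rV_n.+1 => M i j) p0.
  have := congr1 (fun M : 'rV_n.+1 => M i j) q0.
  by rewrite !mxE; case: (v i j) => /= ? ? -> ->.
have ge0 w : 0 <= qform A w by have [_ ] := posdefmx_semi pdA; apply.
have gt0 : 0 < qform A p^T + qform A q^T.
  case/orP: nz => h; [apply: ltr_pwDl | apply: ltr_wpDl] => //; apply: pA;
    by rewrite trmx_eq0.
have be0 : be = 0.
  have := symAB B sB; rewrite pE qE mulmxBl mulmxDl -!scalemxAl symAB //.
  move/matrixP/(_ 0 0); rewrite !mxE.
  have -> : \sum_j (q *m A) 0 j * q^T j 0 = qform A q^T by rewrite -qfE mxE.
  have -> : \sum_j (p *m A) 0 j * p^T j 0 = qform A p^T by rewrite -qfE mxE.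
  move=> e; have : be * (qform A p^T + qform A q^T) = 0 by lra.
  by move/eqP; rewrite mulf_eq0 (gt_eqF gt0) orbF => /eqP.
rewrite be0 !scale0r subr0 in pE; rewrite be0 !scale0r add0r in qE.
exists al; case/orP: nz => h; [exists p^T | exists q^T].
  split; first by rewrite trmx_eq0.
  by rewrite -[B]sB -[A]sA -!trmx_mul pE linearZ.
split; first by rewrite trmx_eq0.
by rewrite -[B]sB -[A]sA -!trmx_mul qE linearZ.
Qed.

(** Used for deflation: a basis of the hyperplane orthogonal to [c], with exactly [n] rows so that
    the compressed matrices have the size required by the induction. *)
Lemma row_free_annihilator (F : fieldType) n (c : 'cV[F]_n.+1) : c != 0 ->
  exists U : 'M[F]_(n, n.+1), row_free U /\ U *m c = 0.
Proof.
move=> c0; have rk : \rank (kermx c) = n.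
  rewrite mxrank_ker; have -> : \rank c = 1%N; last by rewrite subn1.
  by apply/eqP; rewrite eqn_leq rank_leq_col lt0n mxrank_eq0.
have := row_base_free (kermx c).
have : row_base (kermx c) *m c = 0.
  by apply: sub_kermxP; rewrite eq_row_base.
by move: (row_base _); rewrite rk => U UE Uf; exists U.
Qed.

(** Induction by deflation. An eigenvector [u] with [B u = l A u] is scaled to [u^T A u = 1], and
    both forms are restricted to the complement of [u] that is orthogonal for [A], spanned by the
    rows of [U]. Since [B u] is a multiple of [A u], this complement is orthogonal to [u] for [B]
    too, so both matrices become block diagonal in the basis formed by [u] and the columns of
    [U^T Q]. *)
Lemma pencil_diagonalization (R : rcfType) n (A B : 'M[R]_n) :
  posdefmx A -> B^T = B ->
  exists (Q : 'M[R]_n) (d : 'rV[R]_n),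
    Q^T *m A *m Q = 1%:M /\ Q^T *m B *m Q = diag_mx d.
Proof.
elim: n A B => [|n IH] A B pdA sB.
  by exists 0, 0; split; apply/matrixP => -[].
have [l [w [w0 wE]]] := pencil_eigenvector pdA sB.
case: (pdA) => sA pA.
have qw := pA _ w0.
pose u := (Num.sqrt (qform A w))^-1 *: w.
have uE : B *m u = l *: (A *m u) by rewrite -!scalemxAr wE !scalerA mulrC.
have uAu : u^T *m A *m u = 1%:M.
  apply/matrixP => i j; rewrite !ord1 [RHS]mxE mulr1n -/(qform A u).
  have uT : u^T = (Num.sqrt (qform A w))^-1 *: w^T by rewrite linearZ.
  rewrite /qform uT /u -scalemxAr -!scalemxAl scalerA mxE -/(qform A w).
  by rewrite -invfM -expr2 sqr_sqrtr ?ltW // mulVf // gt_eqF.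
have uBu : u^T *m B *m u = l%:M.
  by rewrite -mulmxA uE -scalemxAr mulmxA uAu scale_scalar_mx mulr1.
have Au0 : A *m u != 0.
  apply/eqP => e; move/matrixP: uAu => /(_ 0 0).
  by rewrite -mulmxA e mulmx0 !mxE => /esym/eqP; rewrite oner_eq0.
have [U [Uf UE]] := row_free_annihilator Au0.
have pdU : posdefmx (U *m A *m U^T).
  split; first by rewrite !trmx_mul trmxK sA mulmxA.
  move=> v v0; rewrite -{1}[U]trmxK -qformM; apply: pA.
  rewrite -trmx_eq0 trmx_mul trmxK.
  apply: contra v0 => /eqP e; rewrite -trmx_eq0.
  by move/row_free_inj: Uf => /(_ _ v^T 0) <- //; rewrite e mul0mx.
have sU : (U *m B *m U^T)^T = U *m B *m U^T by rewrite !trmx_mul trmxK sB mulmxA.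
have [Q [d [QA QB]]] := IH _ _ pdU sU.
have UAu : U *m A *m u = 0 by rewrite -mulmxA.
have UBu : U *m B *m u = 0 by rewrite -mulmxA uE -scalemxAr UE scaler0.
have uAU : u^T *m A *m U^T = 0.
  by apply: trmx_inj; rewrite !trmx_mul !trmxK sA mulmxA UAu trmx0.
have uBU : u^T *m B *m U^T = 0.
  by apply: trmx_inj; rewrite !trmx_mul !trmxK sB mulmxA UBu trmx0.
have QT : (row_mx u (U^T *m Q) : 'M[R]_(n.+1, 1 + n))^T = col_mx u^T (Q^T *m U).
  by rewrite tr_row_mx trmx_mul trmxK.
have blockE (M : 'M[R]_n.+1) : col_mx u^T (Q^T *m U) *m M *m row_mx u (U^T *m Q)
    = block_mx (u^T *m M *m u) (u^T *m M *m U^T *m Q)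
        (Q^T *m (U *m M *m u)) (Q^T *m (U *m M *m U^T) *m Q).
  by rewrite mul_col_mx mul_col_row !mulmxA.
exists (row_mx u (U^T *m Q)), (row_mx (const_mx l : 'rV[R]_1) d); split.
  by rewrite QT blockE uAu uAU UAu mul0mx mulmx0 QA -scalar_mx_block.
rewrite QT blockE uBu uBU UBu mul0mx mulmx0 QB.
rewrite -(diag_const_mx 1 l).
have h := diag_mx_row (const_mx l : 'rV[R]_1) d.
by refine (etrans _ (esym h)); congr block_mx.
Qed.

(** * Quadratic forms in coordinates *)

Lemma qform_diag (R : comPzRingType) K (d : 'rV[R]_K) (v : 'cV[R]_K) :
  qform (diag_mx d) v = \sum_j d 0 j * v j 0 ^+ 2.
Proof.
rewrite /qform mul_mx_diag mxE; apply: eq_bigr => j _.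
by rewrite !mxE mulrAC mulrC expr2.
Qed.

Lemma qform1 (R : comPzRingType) K (v : 'cV[R]_K) :
  qform 1%:M v = \sum_j v j 0 ^+ 2.
Proof.
rewrite -(diag_const_mx _ 1) qform_diag.
by apply: eq_bigr => j _; rewrite mxE mul1r.
Qed.

Lemma qform_rank1 (R : comPzRingType) K (x v : 'cV[R]_K) :
  qform (x *m x^T) v = (v^T *m x) 0 0 ^+ 2.
Proof.
rewrite /qform mulmxA -mulmxA -[x^T *m v]mx11_tr trmx_mul trmxK.
by rewrite mxE big_ord1 expr2.
Qed.

Lemma qform_sum (R : pzRingType) K I (r : seq I) (F : I -> 'M[R]_K) v :
  qform (\sum_(i <- r) F i) v = \sum_(i <- r) qform (F i) v.
Proof.
apply: (big_morph (fun A => qform A v)) => [A B|]; first exact: qformD.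
by rewrite /qform mulmx0 mul0mx mxE.
Qed.

Lemma qform_row (R : comPzRingType) K (A P : 'M[R]_K) j :
  (P^T *m A *m P) j j = qform A (col j P).
Proof.
rewrite /qform colE trmx_mul trmx_delta -!mulmxA.
by rewrite -rowE !mulmxA -colE !mxE.
Qed.

(** * Jensen's inequality and strict minimality of fixed points *)

(** Jensen for [ln] at the points [1 / d_j] with weights [w_j / s]. It reduces to [1 + t <= expR t]
    at [t = m - ln d_j], where [m] is the weighted mean of the [ln d_j]. *)
Lemma le_ln_sum (R : realType) n (w d : 'I_n -> R) :
  (forall j, 0 <= w j) -> (forall j, 0 < d j) -> 0 < \sum_j w j ->
  ln (\sum_j w j) - \sum_j w j / (\sum_j w j) * ln (d j)
  <= ln (\sum_j (d j)^-1 * w j).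
Proof.
set s := \sum_j w j => w0 d0 s0.
set m := \sum_j w j / s * ln (d j).
have sE : \sum_j w j / s = 1 by rewrite -mulr_suml divff // gt_eqF.
have key : s * expR (- m) <= \sum_j (d j)^-1 * w j.
  (* The deviations [m - ln d_j] have weighted mean zero, so the tangent-line terms average to 1. *)
  have -> : s * expR (- m)
      = \sum_j s * expR (- m) * (w j / s * (1 - ln (d j) + m)).
    rewrite -mulr_sumr; under eq_bigr do rewrite mulrDr mulrBr mulr1.
    rewrite big_split sumrB /= sE -/m.
    have -> : \sum_j w j / s * m = m by rewrite -mulr_suml sE mul1r.
    by ring.
  apply: ler_sum => j _.
  have -> : (d j)^-1 * w j = s * expR (- m) * (w j / s * expR (- ln (d j) + m)).
    rewrite expRD !expRN lnK ?posrE //.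
    by field; rewrite !gt_eqF // expR_gt0.
  rewrite ler_wpM2l ?mulr_ge0 ?expR_ge0 ?(ltW s0) //.
  rewrite ler_wpM2l ?divr_ge0 ?(ltW s0) //.
  by rewrite -addrA expR_ge1Dx.
apply: le_trans (_ : ln (s * expR (- m)) <= _).
  by rewrite lnM ?posrE ?expR_gt0 // expRK.
by rewrite ler_ln ?posrE ?mulr_gt0 ?expR_gt0 // (lt_le_trans _ key) ?mulr_gt0 ?expR_gt0.
Qed.

Lemma lt_ln_inv (R : realType) (d : R) : 0 < d -> d != 1 -> 0 < d^-1 - 1 + ln d.
Proof.
move=> d0 d1; have l0 : - ln d != 0 by rewrite oppr_eq0 ln_eq0.
by have := expR_gt1Dx l0; rewrite expRN lnK ?posrE //; lra.
Qed.

Lemma kl_loss_fixpoint_lt (R : realType) (K N : nat) (N_gt0 : (0 < N)%N)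
    (x : 'I_N -> 'cV[R]_K) (T : 'M[R]_K) (a : R) (A B : 'M[R]_K) :
  posdefmx T -> 0 < a -> (forall i, x i != 0) ->
  posdefmx A -> A = kl_rhs x T a A -> posdefmx B -> B != A ->
  kl_loss x T a A < kl_loss x T a B.
Proof.
move=> pdT a0 x0 pdA fixA pdB BA.
have [Q [d [QA QB]]] := pencil_diagonalization pdA pdB.1.
have uQ : Q \in unitmx by have [] := mulmx1_unit QA.
have uQT : Q^T \in unitmx by rewrite unitmx_tr.
have Qinj v : v != 0 -> Q *m v != 0.
  by apply: contra => /eqP e; rewrite -(mulKmx uQ v) e mulmx0.
have QTinj v : v != 0 -> Q^T *m v != 0.
  by apply: contra => /eqP e; rewrite -(mulKmx uQT v) e mulmx0.
have colQ0 j : col j Q != 0.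
  rewrite colE Qinj //; apply/eqP => /matrixP /(_ j 0) /eqP.
  by rewrite !mxE !eqxx oner_eq0.
have d0 j : 0 < d 0 j.
  have := qform_row B Q j; rewrite QB !mxE eqxx mulr1n => ->.
  by apply: pdB.2.
have AE : invmx A = Q *m Q^T.
  have e : A *m (Q *m Q^T) = 1%:M.
    by rewrite mulmxA; apply: mulmx1C; rewrite mulmxA.
  by rewrite -[RHS](mulKmx (posdefmx_unit pdA)) e mulmx1.
pose e := map_mx (fun r : R => r^-1) d.
have de : diag_mx d *m diag_mx e = 1%:M.
  rewrite mulmx_diag -(diag_const_mx _ 1); congr diag_mx.
  by apply/rowP => j; rewrite !mxE mulfV // gt_eqF.
have BE : invmx B = Q *m diag_mx e *m Q^T.
  have h : B *m (Q *m diag_mx e *m Q^T) = 1%:M.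
    by rewrite !mulmxA; apply: mulmx1C; rewrite !mulmxA QB.
  by rewrite -[RHS](mulKmx (posdefmx_unit pdB)) h mulmx1.
pose z i := Q^T *m x i.
pose s i := \sum_j z i j 0 ^+ 2.
pose tau j := (Q^T *m T *m Q) j j.
have sE i : qform (invmx A) (x i) = s i.
  by rewrite AE -{1}[Q]trmxK -(mulmx1 Q^T^T) -qformM qform1.
have s'E i : qform (invmx B) (x i) = \sum_j (d 0 j)^-1 * z i j 0 ^+ 2.
  rewrite BE -{1}[Q]trmxK -qformM qform_diag.
  by apply: eq_bigr => j _; rewrite mxE.
have s0 i : 0 < s i by rewrite -sE; apply: (posdefmx_inv pdA).2.
have tau0 j : 0 < tau j by rewrite /tau qform_row; apply: pdT.2.
have trA : \tr (invmx A *m T) = \sum_j tau j.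
  by rewrite AE -mulmxA mxtrace_mulC.
have trB : \tr (invmx B *m T) = \sum_j (d 0 j)^-1 * tau j.
  rewrite BE -!mulmxA mxtrace_mulC -!mulmxA mul_diag_mx.
  by apply: eq_bigr => j _; rewrite mxE [e 0 j]mxE /tau -mulmxA.
have detA0 : \det A = (\det Q ^+ 2)^-1.
  have := congr1 determinant QA; rewrite !det_mulmx det_tr det1 => h.
  have q0 : \det Q != 0 by move: uQ; rewrite unitmxE unitfE.
  by apply: (mulIf (expf_neq0 2 q0)); rewrite mulVf ?expf_neq0 // -h; ring.
have detB0 : \det B = \det A * \prod_j d 0 j.
  have := congr1 determinant QB; rewrite !det_mulmx det_tr det_diag => <-.
  have q0 : \det Q != 0 by move: uQ; rewrite unitmxE unitfE.
  by rewrite detA0; field.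
have detA_gt0 : 0 < \det A.
  rewrite detA0 invr_gt0 exprn_even_gt0 //=.
  by move: uQ; rewrite unitmxE unitfE.
have lnB : ln (\det B) = ln (\det A) + \sum_j ln (d 0 j).
  rewrite detB0 lnM ?posrE ?prodr_gt0 //; congr (_ + _).
  suff [] : 0 < \prod_j d 0 j /\ ln (\prod_j d 0 j) = \sum_j ln (d 0 j) by [].
  elim/big_rec2: _ => [|j u v _ [v0 vE]]; first by rewrite ln1.
  by rewrite mulr_gt0 // lnM ?posrE // vE.
(* The [j]-th diagonal entry of [Q^T A Q = 1], with [A] replaced by the right-hand side of its
   equation and multiplied by [1 + a]. *)
have eqj j : 1 + a = K%:R / N%:R * \sum_i z i j 0 ^+ 2 / s i + a * tau j.
  have := qform_row A Q j; rewrite QA {1}fixA !mxE eqxx mulr1n /kl_rhs.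
  rewrite qformD !qformZ qform_sum -qform_row -/(tau j).
  under eq_bigr do rewrite qformZ qform_rank1 sE.
  have -> : \sum_i (s i)^-1 * ((col j Q)^T *m x i) 0 0 ^+ 2
      = \sum_i z i j 0 ^+ 2 / s i.
    apply: eq_bigr => i _; rewrite mulrC; congr (_ ^+ 2 / _).
    by rewrite tr_col -row_mul mxE.
  set S := \sum_i _ => h.
  have a1 : 1 + a != 0 by rewrite gt_eqF // addr_gt0.
  have := congr1 ( *%R (1 + a)) h; rewrite mulr1 => ->.
  by field; rewrite a1 pnatr_eq0 -lt0n N_gt0.
(* If every [d_j] were 1, then [Q^T B Q = Q^T A Q], and cancelling [Q] would give [B = A]. *)
have [j dj] : exists j, d 0 j != 1.
  apply/existsP; rewrite -negb_forall; apply: contra BA => /forallP h.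
  have dE : d = const_mx 1 by apply/rowP => j; rewrite mxE; apply/eqP.
  move: QB; rewrite dE diag_const_mx -QA => /(can_inj (mulmxK uQ)).
  by move/(can_inj (mulKmx uQT)) => ->.
have gap j0 : 0 <= (d 0 j0)^-1 - 1 + ln (d 0 j0).
  have [->|h] := eqVneq (d 0 j0) 1; first by rewrite ln1 invr1; lra.
  exact/ltW/lt_ln_inv.
have gap_sum : 0 < \sum_j0 tau j0 * ((d 0 j0)^-1 - 1 + ln (d 0 j0)).
  rewrite (bigD1 j) //= ltr_pwDl ?mulr_gt0 ?lt_ln_inv //.
  by apply: sumr_ge0 => k _; rewrite mulr_ge0 // ltW.
have jensen i : ln (s i) - \sum_j0 z i j0 0 ^+ 2 / s i * ln (d 0 j0)
    <= ln (qform (invmx B) (x i)).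
  by rewrite s'E; apply: le_ln_sum => // [k|]; [exact: sqr_ge0|exact: s0].
rewrite /kl_loss lnB trA trB.
under eq_bigr do rewrite sE.
have c0 : 0 <= K%:R / N%:R :> R by rewrite divr_ge0.
have J : K%:R / N%:R * (\sum_i ln (s i)
      - \sum_i \sum_j0 z i j0 0 ^+ 2 / s i * ln (d 0 j0))
    <= K%:R / N%:R * \sum_i ln (qform (invmx B) (x i)).
  by rewrite -sumrB ler_wpM2l // ler_sum.
move: J; rewrite mulrBr exchange_big /=.
(* The samples enter the Jensen correction only through the sums that [eqj] evaluates. *)
have -> : K%:R / N%:R * \sum_j0 \sum_i z i j0 0 ^+ 2 / s i * ln (d 0 j0)
   = \sum_j0 (1 + a - a * tau j0) * ln (d 0 j0).
  rewrite mulr_sumr; apply: eq_bigr => k _.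
  by rewrite -mulr_suml (eqj k); ring.
move=> J.
have : 0 < a * \sum_j0 tau j0 * ((d 0 j0)^-1 - 1 + ln (d 0 j0)) by rewrite mulr_gt0.
(* The right-hand side below is the lower bound for [L B - L A] left by Jensen: the terms
   [(1 + a) * ln d_j] cancel up to [a * tau_j * ln d_j]. *)
have -> : a * \sum_j0 tau j0 * ((d 0 j0)^-1 - 1 + ln (d 0 j0))
  = a * (\sum_j0 (d 0 j0)^-1 * tau j0) - a * (\sum_j0 tau j0)
    + (1 + a) * (\sum_j0 ln (d 0 j0))
    - \sum_j0 (1 + a - a * tau j0) * ln (d 0 j0).
  rewrite !mulr_sumr -!sumrB -big_split -sumrB /=; apply: eq_bigr => k _; ring.
by lra.
Qed.

(** * The spread condition and the recession cone *)

(* Since [0^-1 = 0], the second sum only runs over the support of [d]. *)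
Lemma weighted_dual_vector (R : realFieldType) K (d : 'rV[R]_K) (z : 'cV[R]_K) :
  (forall j, 0 <= d 0 j) -> z != 0 ->
  exists w : 'cV[R]_K, (w^T *m z) 0 0 = 1 /\
    (\sum_j d 0 j * w j 0 ^+ 2) * (\sum_j (d 0 j)^-1 * z j 0 ^+ 2)
      <= [forall j, (d 0 j == 0) ==> (z j 0 == 0)]%:R.
Proof.
move=> d0 z0; have [/forallP good|] := boolP [forall j, (d 0 j == 0) ==> (z j 0 == 0)].
  set q := \sum_j (d 0 j)^-1 * z j 0 ^+ 2.
  have [k zk] : exists k, z k 0 != 0.
    apply/existsP; rewrite -negb_forall; apply: contra z0 => /forallP h.
    by apply/eqP/colP => k; rewrite mxE; apply/eqP.
  have dk : 0 < d 0 k.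
    by rewrite lt0r d0 andbT; apply: contra zk => /(implyP (good k)).
  have q0 : 0 < q.
    rewrite /q (bigD1 k) //= ltr_pwDl //.
      by apply: mulr_gt0; rewrite ?invr_gt0 ?exprn_even_gt0.
    by apply: sumr_ge0 => j _; rewrite mulr_ge0 ?invr_ge0 ?sqr_ge0.
  (* The minimiser of [w^T diag(d) w] under [w^T z = 1], found by Lagrange multipliers; its value is
     [1 / q]. *)
  exists (\col_j ((d 0 j)^-1 * z j 0 / q)); split.
    have qn0 : q != 0 by rewrite gt_eqF.
    rewrite mxE -(divff qn0) {2}/q mulr_suml.
    apply: eq_bigr => j _; rewrite !mxE; ring.
  have -> : \sum_j d 0 j * (\col_j ((d 0 j)^-1 * z j 0 / q)) j 0 ^+ 2 = q / q ^+ 2.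
    rewrite {2}/q mulr_suml; apply: eq_bigr => j _; rewrite !mxE.
    have [->|dj] := eqVneq (d 0 j) 0; first by rewrite invr0 !mul0r.
    by field; rewrite dj gt_eqF.
  suff -> : q / q ^+ 2 * q = 1 by [].
  by field; rewrite gt_eqF.
rewrite negb_forall => /existsP [k]; rewrite negb_imply => /andP [/eqP dk zk].
(* Here [z] has a component in the kernel of [diag(d)], so [w] can be placed there at no cost. *)
exists ((z k 0)^-1 *: delta_mx k 0); split.
  by rewrite linearZ /= trmx_delta -scalemxAl -rowE !mxE mulVf.
rewrite big1 ?mul0r // => j _; rewrite !mxE.
by have [->|] := eqVneq j k; rewrite ?dk ?mul0r //= mulr0 expr0n mulr0.
Qed.

(* Says that the recession cone of the set of [A] with [A <= f A] is trivial.
   For [M = Q^-T diag(d) Q^-1], testing with the columns of [Q] scaled by [1 / d_j]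
   and summing bounds [rank M] by [K / ((1 + a) N)] times the number of samples
   in the range of [M], provided the [y i] are chosen to minimise [qform M]. *)
Lemma spread_recession (R : realType) (K N : nat) (K_gt0 : (0 < K)%N)
    (N_gt0 : (0 < N)%N) (x : 'I_N -> 'cV[R]_K) (a : R) (M : 'M[R]_K) :
  0 < a -> (forall i, x i != 0) ->
  (forall S : {vspace 'cV[R]_K}, (1 <= \dim S <= K - 1)%N ->
     sample_prop x S < (1 + a) * (\dim S)%:R / K%:R) ->
  possemidefmx M ->
  (forall y : 'I_N -> 'cV[R]_K, (forall i, ((y i)^T *m x i) 0 0 = 1) ->
   forall v, qform M v <= 1 / (1 + a) * (K%:R / N%:R) *
     \sum_i qform M (y i) * (v^T *m x i) 0 0 ^+ 2) ->
  M = 0.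
Proof.
move=> a0 x0 spread [sM pM] ub; set c := _ * (_ / _) in ub.
have pd1 : posdefmx (1%:M : 'M[R]_K).
  split; first exact: trmx1.
  move=> v v0; rewrite qform1.
  have [k vk] : exists k, v k 0 != 0.
    apply/existsP; rewrite -negb_forall; apply: contra v0 => /forallP h.
    by apply/eqP/colP => k; rewrite mxE; apply/eqP.
  rewrite (bigD1 k) //= ltr_pwDl ?exprn_even_gt0 //.
  by apply: sumr_ge0 => j _; rewrite sqr_ge0.
(* With the identity as first matrix this is the spectral theorem: [Q] is orthogonal and [d] lists
   the eigenvalues of [M]. *)
have [Q [d [Q1 QM]]] := pencil_diagonalization pd1 sM.
rewrite mulmx1 in Q1; have Q1' := mulmx1C Q1.
have dE j : d 0 j = qform M (col j Q) by rewrite -qform_row QM !mxE eqxx.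
have d0 j : 0 <= d 0 j by rewrite dE.
pose z i := Q^T *m x i.
have z0 i : z i != 0.
  by apply: contra (x0 i) => /eqP e; rewrite -[x i]mul1mx -Q1' -mulmxA -/(z i) e mulmx0.
have [w wP] := fin_all_exists (fun i => weighted_dual_vector d0 (z0 i)).
pose good i := [forall j, (d 0 j == 0) ==> (z i j 0 == 0)].
have y1 i : ((Q *m w i)^T *m x i) 0 0 = 1 by rewrite trmx_mul -mulmxA (wP i).1.
have yM i : qform M (Q *m w i) = \sum_j d 0 j * w i j 0 ^+ 2.
  by rewrite qformM QM qform_diag.
have zE i j : ((col j Q)^T *m x i) 0 0 = z i j 0 by rewrite tr_col -row_mul mxE.
pose J := [set j | d 0 j != 0].
have c0 : 0 <= c by rewrite /c mulr_ge0 ?divr_ge0 // addr_ge0 // ltW.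
have cardJ : #|J|%:R <= c * \sum_i (good i)%:R.
  (* Because [0^-1 = 0], each product is the indicator of [d_j != 0]. *)
  have -> : #|J|%:R = \sum_j (d 0 j)^-1 * d 0 j :> R.
    rewrite -sum1_card natr_sum big_mkcond /=; apply: eq_bigr => j _.
    rewrite inE; case: eqVneq => [->|h]; first by rewrite mulr0.
    by rewrite mulVf.
  apply: le_trans (_ : \sum_j (d 0 j)^-1 *
      (c * \sum_i qform M (Q *m w i) * z i j 0 ^+ 2) <= _).
    apply: ler_sum => j _; rewrite ler_wpM2l ?invr_ge0 // {1}dE.
    apply: le_trans (ub _ y1 (col j Q)) _; rewrite ler_wpM2l //.
    by apply: ler_sum => i _; rewrite zE.
  have -> : \sum_j (d 0 j)^-1 * (c * \sum_i qform M (Q *m w i) * z i j 0 ^+ 2)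
     = c * \sum_i qform M (Q *m w i) * \sum_j (d 0 j)^-1 * z i j 0 ^+ 2.
    under [in RHS]eq_bigr do rewrite mulr_sumr.
    rewrite [in RHS]exchange_big mulr_sumr /=; apply: eq_bigr => j _.
    rewrite mulrCA mulr_sumr; congr (_ * _); apply: eq_bigr => i _; ring.
  rewrite ler_wpM2l //; apply: ler_sum => i _.
  by rewrite yM (wP i).2.
pose S := <<[seq col j Q | j <- enum J]>>%VS.
have dimS : (\dim S <= #|J|)%N.
  by apply: leq_trans (dim_span _) _; rewrite size_map cardE.
have goodS i : good i -> x i \in S.
  move=> /forallP gi; rewrite -[x i]mul1mx -Q1' -mulmxA -/(z i).
  have -> : Q *m z i = \sum_j z i j 0 *: col j Q.
    apply/colP => k; rewrite mxE summxE; apply: eq_bigr => j _.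
    by rewrite !mxE mulrC.
  apply: memv_suml => j _; have [->|zj] := eqVneq (z i j 0) 0.
    by rewrite scale0r mem0v.
  apply/memvZ/memv_span/map_f; rewrite mem_enum inE.
  by apply: contra zj => /(implyP (gi j)).
have sum_le : \sum_i (good i)%:R <= \sum_i (x i \in S)%:R :> R.
  by apply: ler_sum => i _; case: (boolP (good i)) => // /goodS ->.
have N0 : 0 < N%:R :> R by rewrite ltr0n.
have K0 : 0 < K%:R :> R by rewrite ltr0n.
have a1 : 0 < 1 + a by rewrite addr_gt0.
have [J0|] := posnP #|J|.
  have d00 : d = 0.
    apply/rowP => j; rewrite mxE; apply/eqP/negbNE/negP => dj.
    by move/eqP: J0; rewrite cards_eq0 => /eqP /setP /(_ j); rewrite !inE dj.
  by rewrite -[M]mul1mx -[_ *m M]mulmx1 -Q1' -!mulmxA [Q^T *m _]mulmxA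
    [Q^T *m M *m _]mulmxA QM d00 linear0 mul0mx mulmx0.
move=> J_gt0; exfalso.
(* Three cases for [dim S]. If it is 0, no nonzero sample is good and [cardJ] forces [J] to be
   empty. If [S] is proper, [cardJ] contradicts the spread condition. If it is [K], counting all
   samples as good yields [K <= K / (1 + a)]. *)
have [S0|S_gt0] := posnP (\dim S).
  move: cardJ; rewrite big1 ?mulr0 => [|i _].
    by rewrite lern0 => /eqP e; rewrite e in J_gt0.
  case: (boolP (good i)) => // /goodS.
  move/eqP: S0; rewrite dimv_eq0 => /eqP ->; rewrite memv0 => xi0.
  by have := x0 i; rewrite xi0.
have [leK|gtK] := leqP (\dim S) (K - 1).
  have := spread S; rewrite S_gt0 leK => /(_ isT).
  rewrite /sample_prop -(ltr_pM2l K0) -(ltr_pM2l (_ : 0 < (1 + a)^-1)) ?invr_gt0 //.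
  have -> : (1 + a)^-1 * (K%:R * ((1 + a) * (\dim S)%:R / K%:R)) = (\dim S)%:R.
    by field; rewrite !gt_eqF.
  apply/negP; rewrite -leNgt.
  apply: le_trans (_ : #|J|%:R <= _); first by rewrite ler_nat.
  apply: le_trans cardJ _; apply: le_trans (ler_wpM2l c0 sum_le) _.
  set t := \sum_(i < N) _; suff -> : c * t = (1 + a)^-1 * (K%:R * (N%:R^-1 * t)) by [].
  by rewrite /c; ring.
have K_le : (K <= #|J|)%N.
  apply: leq_trans dimS; apply: leq_trans gtK.
  by rewrite -addn1 subnK.
have : (K%:R : R) <= c * N%:R.
  apply: le_trans (_ : #|J|%:R <= _); first by rewrite ler_nat.
  apply: le_trans cardJ _; rewrite ler_wpM2l //.
  apply: le_trans (_ : \sum_(i < N) 1 <= _).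
    by apply: ler_sum => i _; case: (good i).
  by rewrite sumr_const card_ord.
apply/negP; rewrite -ltNge.
have -> : c * N%:R = K%:R / (1 + a) by rewrite /c; field; rewrite !gt_eqF.
by rewrite ltr_pdivrMr // ltr_pMr // ltrDl.
Qed.

(** * Trace bounds and the variational formula for [1 / (x^T A^-1 x)] *)

Lemma qformDZ (R : comPzRingType) K (A : 'M[R]_K) (u v : 'cV[R]_K) (t : R) :
  A^T = A ->
  qform A (u + t *: v)
  = qform A u + t * (u^T *m A *m v) 0 0 *+ 2 + t ^+ 2 * qform A v.
Proof.
move=> sA; have symuv : (v^T *m A *m u) 0 0 = (u^T *m A *m v) 0 0.
  by rewrite -(mx11_tr (v^T *m A *m u)) !trmx_mul trmxK sA mulmxA.
have uvT : (u + t *: v)^T = u^T + t *: v^T by rewrite linearD linearZ.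
rewrite /qform uvT !mulmxDl !mulmxDr -!scalemxAl -!scalemxAr.
rewrite ![(_ + _ : 'M[R]_1) 0 0]mxE ![(_ *: _ : 'M[R]_1) 0 0]mxE symuv; ring.
Qed.

Lemma qform_delta (R : comPzRingType) K (A : 'M[R]_K) j :
  qform A (delta_mx j 0) = A j j.
Proof. by rewrite /qform trmx_delta -rowE -colE !mxE. Qed.

(** Testing on [e_i + e_j] and [e_i - e_j] gives [2 |A_ij| <= A_ii + A_jj]. The trace thus controls
    the whole matrix, which serves both for compactness and for the vanishing of matrices of trace
    zero. *)
Lemma possemidefmx_entry_le (R : realFieldType) K (A : 'M[R]_K) i j :
  possemidefmx A -> `|A i j| <= \tr A.
Proof.
move=> [sA pA].
have d0 k : 0 <= A k k by rewrite -qform_delta.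
have dt k : A k k <= \tr A.
  by rewrite /mxtrace (bigD1 k) //= lerDl sumr_ge0.
have Aij : ((delta_mx i 0 : 'cV[R]_K)^T *m A *m (delta_mx j 0 : 'cV[R]_K)) 0 0 = A i j.
  by rewrite trmx_delta -rowE -colE !mxE.
have := pA (delta_mx i 0 + 1 *: delta_mx j 0).
have := pA (delta_mx i 0 + (-1) *: delta_mx j 0).
rewrite !qformDZ // !qform_delta Aij sqrrN !expr1n.
have := dt i; have := dt j => *; rewrite ler_norml; apply/andP; split; lra.
Qed.

Lemma possemidefmx_trace_eq0 (R : realFieldType) K (A : 'M[R]_K) :
  possemidefmx A -> \tr A <= 0 -> A = 0.
Proof.
move=> pA tA; apply/matrixP => i j; apply/eqP; rewrite mxE -normr_le0.
exact: le_trans (possemidefmx_entry_le i j pA) tA.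
Qed.

Lemma posdefmx_trace_gt0 (R : numDomainType) K (A : 'M[R]_K) :
  (0 < K)%N -> posdefmx A -> 0 < \tr A.
Proof.
move=> K0 [sA pA]; have d0 j : 0 < A j j.
  rewrite -qform_delta; apply: pA; apply/eqP => /matrixP /(_ j 0) /eqP.
  by rewrite !mxE !eqxx oner_eq0.
rewrite /mxtrace (bigD1 (Ordinal K0)) //= ltr_pwDl //.
by apply: sumr_ge0 => j _; apply: ltW.
Qed.

(** With [q = x^T A^-1 x], completing the square shows that the form of [A] at [y - q^-1 A^-1 x]
    equals [y^T A y - 1 / q]. *)
Lemma inv_qform_le (R : realFieldType) K (A : 'M[R]_K) (x y : 'cV[R]_K) :
  posdefmx A -> (y^T *m x) 0 0 = 1 -> (qform (invmx A) x)^-1 <= qform A y.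
Proof.
move=> pdA yx; have uA := posdefmx_unit pdA; have [sA pA] := posdefmx_semi pdA.
have x0 : x != 0.
  apply/eqP => x0; move: yx; rewrite x0 mulmx0 mxE => /esym/eqP.
  by rewrite oner_eq0.
have q0 := (posdefmx_inv pdA).2 _ x0; set q := qform _ x in q0 *.
have := pA (y + (- q^-1) *: (invmx A *m x)).
rewrite qformDZ // qformM trmx_inv sA mulVmx // mul1mx -/q.
rewrite -!mulmxA mulKVmx // yx.
have -> : (- q^-1) ^+ 2 * q = q^-1 by field; rewrite gt_eqF.
lra.
Qed.

Lemma inv_qform_attained (R : realFieldType) K (A : 'M[R]_K) (x : 'cV[R]_K) :
  posdefmx A -> x != 0 ->
  let y := (qform (invmx A) x)^-1 *: (invmx A *m x) in
  (y^T *m x) 0 0 = 1 /\ qform A y = (qform (invmx A) x)^-1.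
Proof.
move=> pdA x0 /=; have uA := posdefmx_unit pdA; have [sA _] := pdA.
have q0 := (posdefmx_inv pdA).2 _ x0; set q := qform _ x in q0 *.
split.
  rewrite linearZ /= trmx_mul trmx_inv sA -scalemxAl mxE -/(qform _ x) -/q.
  by rewrite mulVf ?gt_eqF.
rewrite -[_ *: _]add0r qformDZ // qform0v qformM trmx_inv sA mulVmx // mul1mx.
rewrite -/q trmx0 !mul0mx mxE; field; by rewrite gt_eqF.
Qed.

(** * The fixed-point map and its subsolutions *)

Lemma qform_kl_rhs (R : realType) (K N : nat) (x : 'I_N -> 'cV[R]_K)
    (T : 'M[R]_K) (a : R) (S : 'M[R]_K) v :
  qform (kl_rhs x T a S) v
  = 1 / (1 + a) * (K%:R / N%:R) *
      (\sum_i (qform (invmx S) (x i))^-1 * (v^T *m x i) 0 0 ^+ 2)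
    + a / (1 + a) * qform T v.
Proof.
rewrite /kl_rhs qformD !qformZ qform_sum; congr (_ * _ + _).
by apply: eq_bigr => i _; rewrite qformZ qform_rank1.
Qed.

Lemma kl_rhs_sym (R : realType) (K N : nat) (x : 'I_N -> 'cV[R]_K)
    (T : 'M[R]_K) (a : R) (S : 'M[R]_K) :
  T^T = T -> (kl_rhs x T a S)^T = kl_rhs x T a S.
Proof.
move=> sT; rewrite /kl_rhs linearD !linearZ /= sT linear_sum /=.
congr (_ *: _ + _); apply: eq_bigr => i _.
by rewrite linearZ /= trmx_mul trmxK.
Qed.

(* [s b T <= M <= f M] in the Loewner order, with [f] homogenised and written
   through [1 / (x^T M^-1 x) = min {y^T M y | y^T x = 1}], so that all conditions
   are linear in [(s, M)] and make sense for singular [M]. *)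
Definition kl_subsolution (R : realType) (K N : nat) (x : 'I_N -> 'cV[R]_K)
    (T : 'M[R]_K) (a s : R) (M : 'M[R]_K) : Prop :=
  [/\ M^T = M,
      forall v, s * (a / (1 + a) * qform T v) <= qform M v &
      forall y : 'I_N -> 'cV[R]_K, (forall i, ((y i)^T *m x i) 0 0 = 1) ->
      forall v, qform M v <=
        1 / (1 + a) * (K%:R / N%:R) *
          (\sum_i qform M (y i) * (v^T *m x i) 0 0 ^+ 2)
        + s * (a / (1 + a) * qform T v)].

Lemma kl_subsolution_scale (R : realType) (K N : nat) (x : 'I_N -> 'cV[R]_K)
    (T : 'M[R]_K) (a s k : R) (M : 'M[R]_K) :
  0 <= k -> kl_subsolution x T a s M -> kl_subsolution x T a (k * s) (k *: M).
Proof.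
move=> k0 [sM lo up]; split => [|v|y yx v].
- by rewrite linearZ /= sM.
- by rewrite qformZ -mulrA ler_wpM2l.
have -> : \sum_i qform (k *: M) (y i) * (v^T *m x i) 0 0 ^+ 2
    = k * \sum_i qform M (y i) * (v^T *m x i) 0 0 ^+ 2.
  by rewrite mulr_sumr; apply: eq_bigr => i _; rewrite qformZ -mulrA.
rewrite qformZ; apply: le_trans (ler_wpM2l k0 (up y yx v)) _.
by rewrite mulrDr mulrCA [k * (s * _)]mulrA.
Qed.

Lemma kl_weight_ge0 (R : numFieldType) (K N : nat) (a : R) :
  0 < a -> 0 <= 1 / (1 + a) * (K%:R / N%:R).
Proof. by move=> a0; rewrite mulr_ge0 ?divr_ge0 ?addr_ge0 // ltW. Qed.

Lemma kl_subsolution_prior (R : realType) (K N : nat)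
    (x : 'I_N -> 'cV[R]_K) (T : 'M[R]_K) (a : R) :
  posdefmx T -> 0 < a ->
  kl_subsolution x T a 1 (a / (1 + a) *: T).
Proof.
move=> T_pd a_gt0; have [sT pT] := posdefmx_semi T_pd.
split=> [|v|y yx v]; first by rewrite linearZ /= sT.
  by rewrite mul1r qformZ.
rewrite [X in _ <= _ + X]mul1r qformZ lerDr mulr_ge0 ?kl_weight_ge0 //.
rewrite sumr_ge0 // => i _.
by rewrite qformZ mulr_ge0 ?sqr_ge0 // mulr_ge0 // divr_ge0 ?addr_ge0 // ltW.
Qed.

Lemma kl_subsolution_posdef (R : realType) (K N : nat)
    (x : 'I_N -> 'cV[R]_K) (T : 'M[R]_K) (a s : R) (M : 'M[R]_K) :
  posdefmx T -> 0 < a ->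
  0 < s -> kl_subsolution x T a s M -> posdefmx M.
Proof.
move=> T_pd a_gt0 s0 [sM lo _]; split=> // v v0; apply: lt_le_trans (lo v).
by rewrite !mulr_gt0 ?invr_gt0 ?addr_gt0 //; apply: T_pd.2.
Qed.

(** Choosing for each [y i] the minimiser from [inv_qform_attained] turns the linearised upper bound
    back into [M <= f M]. *)
Lemma kl_subsolution_le_rhs (R : realType) (K N : nat)
    (x : 'I_N -> 'cV[R]_K) (T : 'M[R]_K) (a : R) (M : 'M[R]_K) :
  posdefmx T -> 0 < a -> (forall i, x i != 0) ->
  kl_subsolution x T a 1 M -> possemidefmx (kl_rhs x T a M - M).
Proof.
move=> T_pd a_gt0 x_neq0 sub; have pdM := kl_subsolution_posdef T_pd a_gt0 ltr01 sub.
case: sub => sM _ up; split.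
  by rewrite linearB /= kl_rhs_sym ?T_pd.1 // sM.
move=> v; rewrite qformB subr_ge0 qform_kl_rhs.
pose y i := (qform (invmx M) (x i))^-1 *: (invmx M *m x i).
have yP i := inv_qform_attained pdM (x_neq0 i).
have := up y (fun i => (yP i).1) v; rewrite [X in _ <= _ + X]mul1r.
by under eq_bigr do rewrite /y (yP _).2.
Qed.

(** Monotonicity of [f] in linearised form: [1 / (x^T M^-1 x) <= y^T M y <= y^T (f M) y] for every
    admissible [y]. The lower bound holds because the sample terms of [f M] are nonnegative. *)
Lemma kl_subsolution_rhs (R : realType) (K N : nat)
    (x : 'I_N -> 'cV[R]_K) (T : 'M[R]_K) (a : R) (M : 'M[R]_K) :
  posdefmx T -> 0 < a -> (forall i, x i != 0) ->
  kl_subsolution x T a 1 M -> kl_subsolution x T a 1 (kl_rhs x T a M).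
Proof.
move=> T_pd a_gt0 x_neq0 sub; have pdM := kl_subsolution_posdef T_pd a_gt0 ltr01 sub.
have [_ leM] := kl_subsolution_le_rhs T_pd a_gt0 x_neq0 sub.
have iM0 i : 0 <= (qform (invmx M) (x i))^-1.
  by rewrite invr_ge0 ltW //; apply: (posdefmx_inv pdM).2.
split=> [|v|y yx v]; first by rewrite kl_rhs_sym ?T_pd.1.
  rewrite qform_kl_rhs mul1r lerDr mulr_ge0 ?kl_weight_ge0 // sumr_ge0 // => i _.
  by rewrite mulr_ge0 ?sqr_ge0.
rewrite {1}qform_kl_rhs [X in _ <= _ + X]mul1r lerD2r.
rewrite ler_wpM2l ?kl_weight_ge0 // ler_sum // => i _.
rewrite ler_wpM2r ?sqr_ge0 //.
apply: le_trans (inv_qform_le pdM (yx i)) _.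
by rewrite -subr_ge0 -qformB.
Qed.

(** * Closed sets cut out by linear inequalities *)

Lemma scalar_rV_continuous (R : realType) n (f : 'rV[R]_n -> R) :
  scalar f -> continuous f.
Proof.
move=> fL.
pose g := GRing.isLinear.Build R 'rV[R]_n R^o *%R f fL.
pose F : {scalar 'rV[R]_n} := HB.pack f g.
have -> : f = fun v => \sum_k v 0 k * f (delta_mx 0 k).
  apply/funext => v; rewrite {1}[v]row_sum_delta -[LHS]/(F _) linear_sum.
  by apply: eq_bigr => k _; rewrite linearZ.
apply: continuous_big => [|k _]; first exact: add_continuous.
move=> v; apply: (@cvgMl _ _ (nbhs v)); exact: coord_continuous.
Qed.

Lemma closed_scalar_ge0 (R : realType) n I (P : I -> Prop)
    (f : I -> 'rV[R]_n -> R) :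
  (forall i, P i -> scalar (f i)) ->
  closed [set v | forall i, P i -> 0 <= f i v]%classic.
Proof.
move=> fL.
have -> : [set v | forall i, P i -> 0 <= f i v]%classic
    = (\bigcap_(i in [set i | P i]) (f i @^-1` [set r | 0 <= r]))%classic.
  by apply/seteqP; split.
apply: closed_bigI => i /= Pi.
apply: preimage_closed; last exact: closed_ge.
by move=> v _; apply: scalar_rV_continuous; exact: fL.
Qed.

Lemma scalar_qform (R : comPzRingType) K n (f : {linear 'rV[R]_n -> 'M[R]_K}) v :
  scalar (fun u => qform (f u) v).
Proof. by move=> k u w; rewrite linearP qformD qformZ. Qed.

Lemma scalarD (R : comPzRingType) (U : lmodType R) (f g : U -> R) :
  scalar f -> scalar g -> scalar (fun u => f u + g u).
Proof. by move=> fL gL k u w; rewrite fL gL; ring. Qed.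

Lemma scalarM (R : comPzRingType) (U : lmodType R) (f : U -> R) (c : R) :
  scalar f -> scalar (fun u => f u * c).
Proof. by move=> fL k u w; rewrite fL; ring. Qed.

Lemma scalarN (R : comPzRingType) (U : lmodType R) (f : U -> R) :
  scalar f -> scalar (fun u => - f u).
Proof. by move=> fL k u w; rewrite fL; ring. Qed.

Lemma scalar_sum (R : comPzRingType) (U : lmodType R) I (r : seq I)
    (f : I -> U -> R) :
  (forall i, scalar (f i)) -> scalar (fun u => \sum_(i <- r) f i u).
Proof.
move=> fL k u w; elim: r => [|i r IH]; first by rewrite !big_nil mulr0 addr0.
by rewrite !big_cons fL IH; ring.
Qed.

(** * Compactness and the minimal scaling factor *)

Lemma kl_subsolution_min (R : realType) (K N : nat)
    (x : 'I_N -> 'cV[R]_K) (T : 'M[R]_K) (a : R) :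
  (0 < K)%N -> posdefmx T -> 0 < a ->
  exists s M, [/\ 0 <= s, \tr M = 1, kl_subsolution x T a s M &
    forall s' M', 0 <= s' -> \tr M' = 1 -> kl_subsolution x T a s' M' ->
      s <= s'].
Proof.
move=> K0 T_pd a0.
have [_ pT] := posdefmx_semi T_pd.
have b0 : 0 < a / (1 + a) by rewrite divr_gt0 // addr_gt0.
have trT := posdefmx_trace_gt0 K0 T_pd.
(* A pair [(s, M)] is coded as a row vector of length [1 + K * K], where compactness of boxes and
   the extreme value theorem apply. *)
pose m (v : 'rV[R]_(1 + K * K)) : 'M[R]_K := vec_mx (rsubmx v).
pose t (v : 'rV[R]_(1 + K * K)) : R := v 0 (lshift (K * K) 0).
pose code (s : R) (M : 'M[R]_K) : 'rV[R]_(1 + K * K) := row_mx (const_mx s) (mxvec M).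
have tcode s M : t (code s M) = s by rewrite /t /code row_mxEl mxE.
have mcode s M : m (code s M) = M by rewrite /m /code row_mxKr mxvecK.
pose H := [set v | [/\ 0 <= t v, \tr (m v) = 1
  & kl_subsolution x T a (t v) (m v)]]%classic.
have H0 : (H !=set0)%classic.
  (* This factor scales the prior term, itself a subsolution, to trace 1. *)
  pose k := (a / (1 + a) * \tr T)^-1.
  have k0 : 0 < k by rewrite invr_gt0 mulr_gt0.
  exists (code k (k *: (a / (1 + a) *: T))); split; rewrite ?tcode ?mcode.
  - exact: ltW.
  - by rewrite !mxtraceZ mulVf // gt_eqF // mulr_gt0.
  rewrite -{1}[k]mulr1; apply: kl_subsolution_scale; first exact: ltW.
  exact: kl_subsolution_prior.
have mL : linear m by move=> k u w; rewrite /m !linearP.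
pose mlin : {linear 'rV[R]_(1 + K * K) -> 'M[R]_K} :=
  HB.pack m (GRing.isLinear.Build R 'rV[R]_(1 + K * K) 'M[R]_K *:%R m mL).
have tL : scalar t by move=> k u w; rewrite /t !mxE.
have qL v : scalar (fun u => qform (m u) v) := scalar_qform mlin v.
have trL : scalar (fun u => \tr (m u)).
  by move=> k u w; rewrite mL mxtraceD mxtraceZ.
have eL i j : scalar (fun u => m u i j).
  by move=> k u w; rewrite mL !mxE.
have Hcl : closed H.
  (* Symmetry is also written with inequalities, each pair of indices occurring in both orders. *)
  have -> : H = ([set u | forall i : unit, True -> 0 <= t u]
      `&` [set u | \tr (m u) = 1]
      `&` [set u | forall ij : 'I_K * 'I_K, True ->
             0 <= m u ij.1 ij.2 - m u ij.2 ij.1]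
      `&` [set u | forall v : 'cV[R]_K, True ->
             0 <= qform (m u) v - t u * (a / (1 + a) * qform T v)]
      `&` [set u | forall yv : ('I_N -> 'cV[R]_K) * 'cV[R]_K,
             (forall i, ((yv.1 i)^T *m x i) 0 0 = 1) ->
             0 <= (\sum_i qform (m u) (yv.1 i) * (yv.2^T *m x i) 0 0 ^+ 2)
                    * (1 / (1 + a) * (K%:R / N%:R))
                  + t u * (a / (1 + a) * qform T yv.2)
                  - qform (m u) yv.2])%classic.
    apply/seteqP; split => u /=.
      move=> [t0 tr1 [sM lo up]]; do !split => //.
      - move=> [i j] _ /=; have <- : (m u)^T i j = m u j i by rewrite mxE.
        by rewrite sM subrr.
      - by move=> v _; rewrite subr_ge0.
      - by move=> [y v] /= yx; rewrite subr_ge0 mulrC; apply: up.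
    move=> [[[[t0 tr1] sM] lo] up]; split => //; first exact: t0 tt _.
    split=> [|v|y yx v].
    - apply/matrixP => i j; rewrite mxE; apply/eqP; rewrite eq_le -subr_ge0.
      by rewrite (sM (i, j) I) -subr_ge0 (sM (j, i) I).
    - by rewrite -subr_ge0; exact: lo v I.
    - by rewrite -subr_ge0 [X in X + _ - _]mulrC; exact: up (y, v) yx.
  do ?apply: closedI.
  - by apply: closed_scalar_ge0.
  - have trC : continuous (fun u => \tr (m u)) by apply: scalar_rV_continuous.
    have := @preimage_closed _ _ _ [set r : R | r = 1]%classic (in1W trC).
    by apply; exact: closed_eq.
  - by apply: closed_scalar_ge0 => ij _; apply/scalarD/scalarN.
  - by apply: closed_scalar_ge0 => v _; apply/scalarD/scalarN/scalarM.
  - apply: closed_scalar_ge0 => yv _; apply/scalarD/scalarN => //.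
    apply: scalarD; apply: scalarM => //.
    by apply: scalar_sum => i; apply: scalarM.
have Hco : compact H.
  (* Taking traces in [s b T <= M] bounds [s] by [1 / (b tr T)], and the entries of [M] are bounded
     by its trace 1; [B] exceeds both bounds. *)
  pose B := 1 + (a / (1 + a) * \tr T)^-1.
  have bT0 : 0 < a / (1 + a) * \tr T by rewrite mulr_gt0.
  have B1 : 1 <= B by rewrite lerDl invr_ge0 ltW.
  have Bco : compact [set v : 'rV[R]_(1 + K * K) |
      forall i, `[- B, B]%classic (v ord0 i)]%classic.
    apply: (@rV_compact _  _ (fun=> `[- B, B]%classic)).
    by move=> _; apply: segment_compact.
  apply: subclosed_compact Hcl Bco _ => v [t0 tr1 [sM lo up]] i /=.
  rewrite in_itv /= -ler_norml; case: (split_ordP i) => j ->.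
    rewrite (ord1 j) -/(t v) ger0_norm //.
    have h : t v * (a / (1 + a) * \tr T) <= 1.
      rewrite -[leRHS]tr1 /mxtrace !mulr_sumr; apply: ler_sum => k _.
      rewrite -[T k k]qform_delta -[m v k k]qform_delta; exact: lo.
    apply: le_trans (_ : (a / (1 + a) * \tr T)^-1 <= _); last by rewrite lerDr.
    by rewrite -[leRHS]mul1r ler_pdivlMr.
  case/mxvec_indexP: j => j k.
  have -> : v ord0 (rshift 1 (mxvec_index j k)) = m v j k by rewrite /m !mxE.
  apply: le_trans B1; rewrite -tr1; apply: possemidefmx_entry_le.
  split=> // w; apply: le_trans (lo w).
  by rewrite mulr_ge0 // mulr_ge0 // ltW.
have [v vH vmin] := EVT_min_rV H0 Hco (continuous_subspaceT (scalar_rV_continuous tL)).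
move: vH; rewrite inE => -[t0 tr1 sub].
exists (t v), (m v); split => // s' M' s0' tr1' sub'.
rewrite -(tcode s' M'); apply: vmin; rewrite inE /H /=.
by rewrite tcode mcode.
Qed.

(** * Existence of the fixed point, and conclusion *)

Lemma kl_fixpoint_exists (R : realType) (K N : nat) (K_gt0 : (0 < K)%N)
    (N_gt0 : (0 < N)%N) (x : 'I_N -> 'cV[R]_K) (T : 'M[R]_K) (a : R) :
  posdefmx T -> 0 < a -> (forall i, x i != 0) ->
  (forall S : {vspace 'cV[R]_K}, (1 <= \dim S <= K - 1)%N ->
     sample_prop x S < (1 + a) * (\dim S)%:R / K%:R) ->
  exists A : 'M[R]_K, posdefmx A /\ A = kl_rhs x T a A.
Proof.
move=> T_pd a0 x0 spread.
have [s [M [s0 tr1 sub smin]]] := kl_subsolution_min x K_gt0 T_pd a0.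
have s_gt0 : 0 < s.
  rewrite lt0r s0 andbT; apply/eqP => s_eq0.
  case: sub; rewrite s_eq0 => sM lo up.
  have pM : possemidefmx M by split=> // v; have := lo v; rewrite mul0r.
  have M0 : M = 0.
    apply: (spread_recession K_gt0 N_gt0 a0 x0 spread pM) => y yx v.
    by have := up y yx v; rewrite mul0r addr0.
  by move: tr1; rewrite M0 mxtrace0 => /esym/eqP; rewrite oner_eq0.
pose A := s^-1 *: M.
have subA : kl_subsolution x T a 1 A.
  rewrite -(mulVf (lt0r_neq0 s_gt0)); apply: kl_subsolution_scale => //.
  by rewrite invr_ge0.
have pdA := kl_subsolution_posdef T_pd a0 ltr01 subA.
have sub' := kl_subsolution_rhs T_pd a0 x0 subA.
set A' := kl_rhs x T a A in sub'.
have tr' := posdefmx_trace_gt0 K_gt0 (kl_subsolution_posdef T_pd a0 ltr01 sub').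
(* Normalised to trace 1, [A'] competes with [M] at parameter [1 / tr A']. Minimality of [s] then
   gives [tr A' <= 1 / s = tr A], so the semidefinite matrix [A' - A] vanishes. *)
have le_s : s <= (\tr A')^-1.
  apply: (smin _ ((\tr A')^-1 *: A')); first by rewrite invr_ge0 ltW.
    by rewrite mxtraceZ mulVf // gt_eqF.
  rewrite -[X in kl_subsolution _ _ _ X]mulr1.
  by apply: kl_subsolution_scale => //; rewrite invr_ge0 ltW.
exists A; split=> //; apply/esym/eqP; rewrite -subr_eq0; apply/eqP.
apply: possemidefmx_trace_eq0; first exact: kl_subsolution_le_rhs.
rewrite linearB /= subr_le0 /A mxtraceZ tr1 mulr1.
by rewrite -[leLHS]invrK lef_pV2 // posrE ?invr_gt0.
Qed.

Theorem theorem11 (R : realType) (K N : nat) (K_gt0 : (0 < K)%N)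
    (N_gt0 : (0 < N)%N) (x : 'I_N -> 'cV[R]_K) (T : 'M[R]_K) (alpha0 : R)
    (T_posdef : posdefmx T) (alpha0_gt0 : 0 < alpha0)
    (x_neq0 : forall i : 'I_N, x i != 0)
    (x_spread : forall S : {vspace 'cV[R]_K}, (1 <= \dim S <= K - 1)%N ->
       sample_prop x S < (1 + alpha0) * (\dim S)%:R / K%:R) :
  (exists! Sigma : 'M[R]_K,
     posdefmx Sigma /\ Sigma = kl_rhs x T alpha0 Sigma) /\
  (forall Sigma : 'M[R]_K,
     posdefmx Sigma -> Sigma = kl_rhs x T alpha0 Sigma ->
     forall Sigma' : 'M[R]_K, posdefmx Sigma' ->
       kl_loss x T alpha0 Sigma <= kl_loss x T alpha0 Sigma').
Proof.
have lossP := kl_loss_fixpoint_lt N_gt0 T_posdef alpha0_gt0 x_neq0.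
have [A [pdA fixA]] :=
  kl_fixpoint_exists K_gt0 N_gt0 T_posdef alpha0_gt0 x_neq0 x_spread.
split.
  exists A; split=> // B [pdB fixB].
  (* Two distinct solutions would each have strictly smaller loss than the other. *)
  apply/eqP; rewrite eq_sym; apply: contraT => BA.
  have := lt_trans (lossP A B pdA fixA pdB BA).
  by rewrite eq_sym in BA; move/(_ _ (lossP B A pdB fixB pdA BA)); rewrite ltxx.
move=> B pdB fixB C pdC; have [->|CB] := eqVneq C B; first exact: lexx.
exact/ltW/lossP.
Qed.
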